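(* Let $G$ be a countable, finitely generated amenable group and let $A$ be a finite set. The set of strongly irreducible shifts in $A^G$ is not a $G_\delta$ subset of the space $\mathfrak{S}$ of all shifts in $A^G$.
   Context: $A^G$ carries the product topology ($A$ discrete), and $G$ acts on it by $[gx](h)=x(g^{-1}h)$. A shift is a closed $G$-invariant subset $X\subseteq A^G$. For finite $K\subset G$, $x_K$ is the restriction of $x$ to $K$ and $X_K=\{x_K : x\in X\}$. The space $\mathfrak{S}$ of all shifts in $A^G$ has the Hausdorff topology, which is compact and Polish; $X^n\to X$ if and only if for every finite $K\subset G$ one has $X^n_K=X_K$ for all large enough $n$. A subset of $\mathfrak{S}$ is a $G_\delta$ if it is a countable intersection of open sets. Fix a left-invariant word metric $d$ on $G$. A shift $X$ is strongly irreducible if there is $r\in\mathbb{N}$ such that for all finite $K,H\subset G$ with $d(k,h)>r$ for all $k\in K$, $h\in H$, and all $x,y\in X$, there is $z\in X$ with $z_K=x_K$ and $z_H=y_H$.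
   Formalization: The group G is assumed infinite and A is assumed to have at least two elements; if G is finite or A has at most one element, every shift is strongly irreducible, so the set is the whole space and is a Gδ. *)

(* Defs.v *)
From HB Require Import structures.
From mathcomp Require Import all_boot all_order all_algebra finmap.
From mathcomp Require Import all_classical all_reals topology normedtype.
From mathcomp Require Import borel_hierarchy.
Import numFieldNormedType.Exports.

Set Implicit Arguments.
Unset Strict Implicit.
Unset Printing Implicit Defensive.

Import Order.TTheory GRing.Theory Num.Theory.
Local Open Scope classical_set_scope.
Local Open Scope ring_scope.

Section Groups.
Variable G : groupType.

(* Words over S and its inverses, so that S need not be symmetric. *)
Definition word_over (S : {fset G}) (w : seq G) : bool :=
  all (fun s => (s \in S) || ((s^-1)%g \in S)) w.

Definition word_lengths (S : {fset G}) (g : G) : set nat :=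
  [set n | exists w, [/\ word_over S w, size w = n & (\prod_(s <- w) s)%g = g]].

Definition generates (S : {fset G}) : Prop :=
  forall g, word_lengths S g !=set0.

(* The least element of [word_lengths S g]; a junk value if there is none,
   which does not happen when S generates G. *)
Definition word_length (S : {fset G}) (g : G) : nat :=
  get [set n | word_lengths S g n /\
               forall m, word_lengths S g m -> (n <= m)%N].

Definition word_dist (S : {fset G}) (g h : G) : nat :=
  word_length S (g^-1 * h)%g.

Definition fset_symdiff (E F : {fset G}) : {fset G} :=
  ((E `\` F) `|` (F `\` E))%fset.

Definition ltranslate (g : G) (F : {fset G}) : {fset G} :=
  [fset (g * h)%g | h in F]%fset.

Definition folner_sequence (F : nat -> {fset G}) : Prop :=
  (forall n, F n != fset0) /\
  forall g : G,
    (fun n => #|` fset_symdiff (ltranslate g (F n)) (F n)|%:R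
                / #|` F n|%:R : rat^o) @ \oo --> (0 : rat^o).

Definition amenable : Prop := exists F, folner_sequence F.

End Groups.

Notation config G A := {ptws G -> discrete_topology A}.

Section Shifts.
Variables (G : groupType) (A : finType).

Definition shift_act (g : G) (x : config G A) : config G A :=
  fun h => x (g^-1 * h)%g.

Record subshift := Subshift {
  shift_set : set (config G A);
  shift_set_closed : closed shift_set;
  shift_set_invariant : forall g x, shift_set x -> shift_set (shift_act g x) }.

HB.instance Definition _ := gen_eqMixin subshift.
HB.instance Definition _ := gen_choiceMixin subshift.

Definition restr (K : {fset G}) (x : config G A) : {ffun K -> A} :=
  [ffun k : K => x (val k)].

Definition strongly_irreducible (S : {fset G}) (X : subshift) : Prop :=
  exists r : nat, forall K H : {fset G},
    (forall k h, k \in K -> h \in H -> (r < word_dist S k h)%N) ->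
    forall x y, shift_set X x -> shift_set X y ->
    exists z, [/\ shift_set X z, restr K z = restr K x & restr H z = restr H y].

(* The space of shifts carries the Hausdorff uniformity induced by the product
  uniformity of [config G A].  The latter is compact, so this is the topology of
  the Hausdorff distance of any compatible distance on [config G A]; the empty
  shift is an isolated point.  See [shift_cvgP]. *)

Definition hausdorff_rel (E : set (config G A * config G A)) :
    set (subshift * subshift) :=
  [set XY | (forall x, shift_set XY.1 x -> exists2 y, shift_set XY.2 y & E (x, y)) /\
            (forall y, shift_set XY.2 y -> exists2 x, shift_set XY.1 x & E (x, y))].

Definition hausdorff_entourage : set_system (subshift * subshift) :=
  filter_from entourage hausdorff_rel.

Let hausdorff_relS E F : E `<=` F -> hausdorff_rel E `<=` hausdorff_rel F.
Proof.
move=> EF [X Y] [/= XY YX]; split=> /= z.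
  by move=> /XY[t Yt /EF]; exists t.
by move=> /YX[t Xt /EF]; exists t.
Qed.

Let hausdorff_filter : Filter hausdorff_entourage.
Proof.
apply: filter_from_filter; first by exists setT; exact: entourageT.
move=> E F entE entF; exists (E `&` F); first exact: filterI.
by move=> XY EF; split; apply: hausdorff_relS EF => ? [].
Qed.

Let hausdorff_refl U : hausdorff_entourage U -> diagonal `<=` U.
Proof.
move=> [E entE EU] [X Y] /diagonalP<-; apply: EU.
by split=> /= z Xz; exists z => //; exact: entourage_refl.
Qed.

Let hausdorff_inv U :
  hausdorff_entourage U -> hausdorff_entourage (U^-1)%relation.
Proof.
move=> [E entE EU]; exists (E^-1)%relation; first exact: entourage_inv.
by move=> [X Y] [/= XY YX]; apply: EU; split.
Qed.

Let hausdorff_split U : hausdorff_entourage U ->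
  exists2 V, hausdorff_entourage V & (V \; V `<=` U)%relation.
Proof.
move=> [E entE EU]; exists (hausdorff_rel (split_ent E)).
  by exists (split_ent E).
move=> [X Z] [Y [/= XY YX] [/= YZ ZY]]; apply: EU; split=> /= u.
  move=> /XY[v /YZ[w Zw vw] uv]; exists w => //.
  exact: (entourage_split v).
move=> /ZY[v /YX[w Xw wv] vu]; exists w => //.
exact: (entourage_split v).
Qed.

HB.instance Definition _ := isUniform.Build subshift
  hausdorff_filter hausdorff_refl hausdorff_inv hausdorff_split.

End Shifts.

Section Facts.
Variables (G : groupType) (A : finType).

Lemma word_distP (S : {fset G}) (g h : G) (r : nat) : generates S ->
  (word_dist S g h <= r)%N <->
  exists w, [/\ word_over S w, (size w <= r)%N &
                h = (g * \prod_(s <- w) s)%g].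
Proof.
move=> genS; rewrite /word_dist /word_length.
set P := [set n | _ /\ _]; have [] : P (get P).
  have [n Wn] := genS (g^-1 * h)%g.
  have exn : exists n, `[< word_lengths S (g^-1 * h)%g n >].
    by exists n; apply/asboolP.
  apply: (@getPex _ P); case: (ex_minnP exn) => m /asboolP Wm min_m.
  by exists m; split=> // k Wk; apply: min_m; apply/asboolP.
move=> [w [Sw <- wE]] minP; split=> [wr|[v [Sv vr hE]]].
  by exists w; split; rewrite // wE mulgA mulgV mul1g.
apply: leq_trans vr; apply: minP; exists v; split=> //.
by rewrite hE mulKg.
Qed.

Lemma eq_restrP (K : {fset G}) (x y : config G A) :
  restr K x = restr K y <-> {in K, x =1 y}.
Proof.
split=> [/ffunP xy k kK|xy]; first by have := xy [` kK]%fset; rewrite !ffunE.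
by apply/ffunP => k; rewrite !ffunE; exact/xy/valP.
Qed.

Lemma entourage_configP (E : set (config G A * config G A)) :
  entourage E <-> exists K, [set xy | restr K xy.1 = restr K xy.2] `<=` E.
Proof.
split=> [[_ [F _ <-] FE]|[K KE]].
  pose K : seq G := [seq (sval p).1 | p <- enum_fset F].
  exists (seq_fset tt K) => -[x y] /= /eq_restrP xy; apply: FE => p pF.
  have /xy : ((sval p).1 : G) \in seq_fset tt K.
    by rewrite seq_fsetE; exact: map_f.
  case: p {pF} => -[i V] /= /asboolP[W entW WV] xyi; apply: WV.
  by rewrite /unstable.map_pair /preimage /= /proj xyi; exact: entourage_refl.
apply: filterS KE _.
have -> : [set xy | restr K xy.1 = restr K xy.2] =
    \bigcap_(k in [set` K]) [set xy : config G A * config G A | xy.1 k = xy.2 k].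
  by apply/seteqP; split=> -[x y] /=; rewrite eq_restrP.
apply: filter_bigI => k _.
have entk : @entourage (initial_topology (@proj G (fun=> discrete_topology A) k))
    [set xy | xy.1 k = xy.2 k].
  exists [set ab | ab.1 = ab.2] => //.
  by rewrite uniform_discrete => _ [a _ <-].
have ik : `[< @entourage (initial_topology (@proj G (fun=> discrete_topology A) k))
    [set xy | xy.1 k = xy.2 k] >] by exact/asboolP.
exists [set xy | xy.1 k = xy.2 k] => //.
pose f (p : {p : {classic G} * set (config G A * config G A) |
  `[< @entourage (initial_topology (@proj G (fun=> discrete_topology A) p.1)) p.2 >]}) :=
  (sval p).2.
exact: (@finI_from1 _ _ setT f (exist _ (k, _) ik)).
Qed.

Lemma shift_cvgP (X_ : nat -> subshift G A) (X : subshift G A) :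
  X_ @ \oo --> X <->
  forall K, \forall n \near \oo, restr K @` shift_set (X_ n) = restr K @` shift_set X.
Proof.
split=> [XX K|XX].
  pose E : set (config G A * config G A) := [set xy | restr K xy.1 = restr K xy.2].
  have entE : @entourage (subshift G A) (hausdorff_rel E).
    by exists E => //; apply/entourage_configP; exists K.
  move/cvg_app_entourageP : XX => /(_ _ entE).
  apply: filterS => n -[/= XXn XnX]; apply/seteqP; split=> _ [x Xx <-].
    by have [y Xy <-] := XnX _ Xx; exists y.
  by have [y Xy ->] := XXn _ Xx; exists y.
apply/cvg_app_entourageP => U [E /entourage_configP[K KE] EU].
apply: filterS (XX K) => n XnX; apply: EU; split=> /= x Xx.
  have [y Xy yx] : (restr K @` shift_set (X_ n)) (restr K x) by rewrite XnX; exists x.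
  by exists y => //; apply: KE => /=.
have [y Xy yx] : (restr K @` shift_set X) (restr K x) by rewrite -XnX; exists x.
by exists y => //; apply: KE => /=.
Qed.

End Facts.

(* Main.v *)
Require Import Defs.
From mathcomp Require Import all_boot all_order all_algebra finmap.
From mathcomp Require Import all_classical all_reals topology normedtype.
From mathcomp Require Import borel_hierarchy.
From mathcomp Require Import zify.

Set Implicit Arguments.
Unset Strict Implicit.

Local Open Scope classical_set_scope.

(** Call B a gluing set of X when any two finite patterns of X whose supports
    are B-far apart can be glued; X is strongly irreducible iff some ball is a
    gluing set.  By compactness a decreasing sequence of shifts whose patterns on
    an increasing sequence of finite sets stabilize converges to its intersection,
    so a Baire argument reduces the theorem to: a nontrivial strongly irreducible
    X contains, as close to X as desired, a nontrivial strongly irreducible Y for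
    which a prescribed finite set B0 is not gluing.

    Let B be gluing for X and F a large finite set, and let p be a point of X
    whose restriction to F contains all the K-patterns of X.  Let Y consist of
    the points of X in which every translate of U = F B F^-1 meets an occurrence
    of p|F.  Then Y has the same K-patterns as X, and a greedy argument shows that
    it is strongly irreducible.  If B0 were gluing for Y, two letters could be
    chosen freely on a maximal B0-separated subset P of U F.  Each u F meets P in
    at least m points, where m is of order |F|, while |U| <= |F|^2 |B| < 2^m, so by
    counting some choice of letters rules out an occurrence of p|F at each u in U,
    which contradicts the definition of Y. *)

(** * Compactness of the space of configurations *)

Section Compactness.
Context {G : groupType} {A : finType}.
Implicit Types (x y z : config G A) (C D : set (config G A)).

Lemma nbhs_restr (K : {fset G}) x : nbhs x [set y | restr K x = restr K y].
Proof.
pose E : set (config G A * config G A) := [set xy | restr K xy.1 = restr K xy.2].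
have entE : entourage E by apply/entourage_configP; exists K.
by rewrite -nbhs_entourageE; exists E => // y; rewrite /xsection /= inE.
Qed.

Lemma closed_local (K : {fset G}) C :
  (forall x y, {in K, x =1 y} -> C y -> C x) -> closed C.
Proof.
move=> CK x clx; have [y [Cy /eq_restrP xy]] := clx _ (nbhs_restr K x).
exact: CK xy Cy.
Qed.

Lemma config_compact : compact [set: config G A].
Proof.
have Acpt (g : G) : compact [set: discrete_topology A].
  have finA : finite_set [set: A] by exact: finite_finset.
  exact: (@finite_compact (discrete_topology A)).
have := tychonoff Acpt.
by congr compact; apply/seteqP; split.
Qed.

(** The finite intersections of the [C i] generate a proper filter; by compactness it has a cluster
    point, which lies in each closed [C i]. *)
Lemma config_finI (I : choiceType) (C : I -> set (config G A)) :
  (forall i, closed (C i)) ->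
  (forall s : seq I, exists x, forall i, i \in s -> C i x) ->
  exists x, forall i, C i x.
Proof.
move=> clC finC.
pose B (s : seq I) : set (config G A) := [set x | forall i, i \in s -> C i x].
have FF : ProperFilter (filter_from setT B).
  apply: filter_from_proper => [|s _]; last exact: finC.
  apply: filter_from_filter; first by exists [::].
  move=> s t _ _; exists (s ++ t) => // x xst.
  by split=> i i_in; apply: xst; rewrite mem_cat i_in ?orbT.
have [|x [_ clx]] := @config_compact (filter_from setT B) FF; first exact: filterT.
exists x => i; apply: clC => U Ux; apply: clx => //.
by exists [:: i] => // y; apply; rewrite mem_head.
Qed.

End Compactness.

(** * Products and separated subsets of finite sets in a group *)

Section FinsetProducts.
Context {G : groupType}.
Implicit Types (B D E F : {fset G}) (g h : G).
Local Open Scope group_scope.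

Definition fmul E F : {fset G} :=
  seq_fset tt [seq g * h | g <- enum_fset E, h <- enum_fset F].

Definition finv E : {fset G} := [fset g^-1 | g in E]%fset.

Lemma fmulP E F x :
  reflect (exists g h, [/\ g \in E, h \in F & x = g * h]) (x \in fmul E F).
Proof.
rewrite seq_fsetE; apply: (iffP allpairsP) => [[[g h] /=]|[g [h]]].
  by exists g, h.
by exists (g, h).
Qed.

Lemma mem_fmul E F g h : g \in E -> h \in F -> g * h \in fmul E F.
Proof. by move=> gE hF; apply/fmulP; exists g, h. Qed.

Lemma mem_finv E g : (g^-1 \in finv E) = (g \in E).
Proof.
apply/imfsetP/idP => [[h hE /invg_inj->]//|gE].
by exists g.
Qed.

Lemma card_fmul E F : (#|` fmul E F| <= #|` E| * #|` F|)%N.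
Proof.
rewrite size_seq_fset; apply: leq_trans (size_undup _) _.
by rewrite size_allpairs.
Qed.

Lemma card_finv E : #|` finv E| = #|` E|.
Proof. by rewrite card_imfset //; exact: invg_inj. Qed.

(** Run through [D], keeping a new element only if no kept one is close to it; symmetry of [B] gives
    separation in both orders. *)
Lemma maximal_separated B D : 1 \in B -> (forall b, b \in B -> b^-1 \in B) ->
  exists P : {fset G}, [/\ (P `<=` D)%fset,
    {in P &, forall q q', q != q' -> q^-1 * q' \notin B} &
    forall x, x \in D -> exists2 q, q \in P & q^-1 * x \in B].
Proof.
move=> B1 Bsym.
suff [P [PD Psep Pmax]] : exists P : {fset G}, [/\ {subset P <= enum_fset D},
    {in P &, forall q q', q != q' -> q^-1 * q' \notin B} &
    forall x, x \in enum_fset D -> exists2 q, q \in P & q^-1 * x \in B].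
  by exists P; split=> //; apply/fsubsetP.
elim: (enum_fset D) => [|x s [P [Ps Psep Pmax]]].
  by exists fset0; split=> // q; rewrite ?in_fset0.
have [[q qP qx]|xfar] := pselect (exists2 q, q \in P & q^-1 * x \in B).
  exists P; split=> // [y /Ps|y]; first by rewrite inE orbC => ->.
  by rewrite inE => /predU1P[->|/Pmax//]; exists q.
exists (x |` P)%fset; split=> [y|q q'|y].
- by rewrite !inE => /predU1P[->|/Ps ->]; rewrite ?eqxx ?orbT.
- rewrite !inE => /predU1P[->|qP] /predU1P[->|q'P].
  + by rewrite eqxx.
  + move=> _; apply/negP => /Bsym; rewrite invgM invgK => q'x.
    by apply: xfar; exists q'.
  + by move=> _; apply/negP => qx; apply: xfar; exists q.
  + exact: Psep.
- rewrite inE => /predU1P[->|/Pmax[q qP qy]].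
    by exists x; rewrite ?inE ?eqxx // mulVg.
  by exists q => //; rewrite !inE qP orbT.
Qed.

(** Every bad [g] lies in the finite set [fmul D (finv E)]. *)
Lemma fresh_translate D E : infinite_set [set: G] ->
  exists g, forall k, k \in E -> g * k \notin D.
Proof.
move=> /infinite_set_fsetP/(_ #|` fmul D (finv E)|.+1)[L _ ltL].
have /fset0Pn[g] : (L `\` fmul D (finv E))%fset != fset0.
  apply/negP; rewrite fsetD_eq0 => /fsubset_leq_card.
  by rewrite leqNgt ltL.
rewrite inE => /andP[gDE _]; exists g => k kE.
apply: contra gDE => gkD; apply/fmulP; exists (g * k), k^-1.
by rewrite mem_finv mulgK.
Qed.

End FinsetProducts.

(** * Counting Boolean assignments *)

Section PartialAssignments.
Local Open Scope set_scope.

(** Union bound: at most 2^(|T| - m) functions agree with [v i] on all of [D i], and there are fewer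
    than 2^m indices. *)
Lemma avoid_partial_assignments (T I : finType) (D : I -> {set T})
    (v : I -> T -> bool) (m : nat) :
  (forall i, (m <= #|D i|)%N) -> (#|I| < 2 ^ m)%N ->
  exists f : T -> bool, forall i, exists2 t, t \in D i & f t != v i t.
Proof.
move=> mD ltI.
pose agree i : {set {ffun T -> bool}} :=
  [set f : {ffun T -> bool} | [forall t in D i, f t == v i t]].
have card_agree i : (#|agree i| * 2 ^ m <= 2 ^ #|T|)%N.
  pose W t : {pred bool} := if t \in D i then pred1 (v i t) else predT.
  have -> : #|agree i| = #|family W|.
    apply: eq_card => f; rewrite inE; apply/forallP/familyP => fW t.
      by rewrite /W; case: ifP (fW t) => //= _; rewrite inE.
    by have := fW t; rewrite /W; case: ifP => //= _; rewrite inE.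
  rewrite card_family foldrE big_map big_enum /=.
  rewrite (bigID (mem (D i))) /= big1 ?mul1n; last first.
    by move=> t tD; rewrite /W tD card1.
  rewrite (eq_bigr (fun=> 2)) => [|t tD]; last by rewrite /W (negPf tD) card_bool.
  rewrite prod_nat_const -expnD leq_exp2l //.
  rewrite -(cardC (mem (D i))) addnC leq_add2r; exact: mD.
have : (#|\bigcup_i agree i| < #|{: {ffun T -> bool}}|)%N.
  rewrite card_ffun card_bool -(@ltn_pmul2r (2 ^ m)) ?expn_gt0 //.
  apply: (@leq_ltn_trans (#|I| * 2 ^ #|T|)); last first.
    by rewrite mulnC ltn_pmul2l ?expn_gt0.
  apply: (@leq_trans ((\sum_i #|agree i|) * 2 ^ m)).
    rewrite leq_pmul2r ?expn_gt0 //.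
    elim/big_rec2: _ => [|i n E _ leE]; first by rewrite cards0.
    by apply: leq_trans (leq_card_setU _ _) _; rewrite leq_add2l.
  rewrite big_distrl /= -sum_nat_const; exact: leq_sum.
rewrite -[X in (_ < X)%N]cardsT ltnNge => /negP ltU.
have [f fU] : exists f : {ffun T -> bool}, f \notin \bigcup_i agree i.
  have [//|sub] := pselect (exists f : {ffun T -> bool}, f \notin \bigcup_i agree i).
  case: ltU; apply/subset_leq_card/fintype.subsetP => f _.
  by apply/negPn/negP => fU; apply: sub; exists f.
exists f => i; move: fU; apply: contraPP => nt.
apply/negP; rewrite negbK; apply/bigcupP; exists i => //; rewrite inE.
apply/forall_inP => t tD; apply/negPn/negP => ft; apply: nt.
by exists t.
Qed.

End PartialAssignments.

Lemma exists_square_lt_exp2 (a b c : nat) :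
  exists m, ((a + b * m) ^ 2 * c < 2 ^ m)%N.
Proof.
(* For this [m] the left side is at most 2^8 C^5 < 2^(8 + 5C) <= 2^(16C). *)
pose C := (a + b + c).+1; exists (16 * C)%N.
have le1 : ((a + b * (16 * C)) ^ 2 * c <= (16 * C ^ 2) ^ 2 * C)%N.
  rewrite leq_mul ?leq_exp2r //; last by rewrite /C; lia.
  rewrite /C; nia.
apply: leq_ltn_trans le1 _.
have -> : ((16 * C ^ 2) ^ 2 * C = 2 ^ 8 * C ^ 5)%N by rewrite expnMn -expnM; lia.
apply: (@leq_trans (2 ^ 8 * (2 ^ C) ^ 5)).
  by rewrite ltn_pmul2l // ltn_exp2r // ltn_expl.
by rewrite -expnM -expnD leq_exp2l // /C; lia.
Qed.

(** * Gluing sets *)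

Section Gluing.
Context {G : groupType} {A : finType}.
Implicit Types (X Y : subshift G A) (x y z p : config G A).
Implicit Types (B C F K H P Q U : {fset G}).
Local Open Scope group_scope.

(** An arbitrary finite set replaces the ball, so that no generating set is involved and product
    sets can serve directly as gluing sets. *)
Definition glues B X := forall K H,
  (forall k h, k \in K -> h \in H -> k^-1 * h \notin B) ->
  forall x y, shift_set X x -> shift_set X y ->
  exists z, [/\ shift_set X z, {in K, z =1 x} & {in H, z =1 y}].

Lemma gluesS B B' X : (B `<=` B')%fset -> glues B X -> glues B' X.
Proof.
move=> /fsubsetP BB' glX K H KH; apply: glX => k h kK hH.
exact: contra (BB' _) (KH _ _ kK hH).
Qed.

Lemma symmetric_superset B : exists B',
  [/\ (B `<=` B')%fset, 1 \in B' & forall b, b \in B' -> b^-1 \in B'].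
Proof.
exists (1 |` (B `|` finv B))%fset; split=> [||b]; last 1 first.
- rewrite !inE => /or3P[/eqP->|bB|]; first by rewrite invg1 eqxx.
  + by rewrite mem_finv bB !orbT.
  + by rewrite -{1}(invgK b) mem_finv => ->; rewrite orbT.
- by apply/fsubsetP => b bB; rewrite !inE bB orbT.
- by rewrite !inE eqxx.
Qed.

Lemma glue_separated B X P v : glues B X -> shift_set X !=set0 ->
  {in P &, forall q q', q != q' -> q^-1 * q' \notin B} ->
  (forall q, exists2 x, shift_set X x & x q = v q) ->
  exists2 z, shift_set X z & {in P, z =1 v}.
Proof.
move=> glX X0 Psep Xv.
suff [z Xz zP] : exists2 z, shift_set X z & {in enum_fset P, z =1 v} by exists z.
have : {subset enum_fset P <= P} by [].
elim: (enum_fset P) (fset_uniq P) => [|q s IHs] /=.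
  by have [z Xz] := X0; exists z.
move=> /andP[qs /IHs{}IHs] qsP.
have [|z Xz zs] := IHs; first by move=> r rs; apply: qsP; rewrite inE rs orbT.
have [x Xx xq] := Xv q.
have [|t [Xt ts tq]] := glX (seq_fset tt s) [fset q]%fset _ z x Xz Xx.
  move=> k h; rewrite seq_fsetE => ks /fset1P->; apply: Psep.
  - by apply: qsP; rewrite inE ks orbT.
  - by apply: qsP; rewrite mem_head.
  - by apply: contraNneq qs => <-.
exists t => // r; rewrite inE => /predU1P[->|rs]; first by rewrite tq ?inE.
by rewrite ts ?seq_fsetE // zs.
Qed.

(** There are finitely many patterns on [K]; each one occurring in [X] is in turn moved far from the
    support [C] built so far and glued to it. *)
Lemma universal_pattern B X K : infinite_set [set: G] ->
  glues B X -> shift_set X !=set0 -> exists C x0, [/\ shift_set X x0 &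
    forall x, shift_set X x -> exists g,
      forall k, k \in K -> g * k \in C /\ x0 (g * k) = x k].
Proof.
move=> Ginf glX [x1 Xx1].
suff [C [x0 [Xx0 x0P]]] : exists C x0, shift_set X x0 /\
    forall x, shift_set X x -> restr K x \in enum {ffun K -> A} -> exists g,
      forall k, k \in K -> g * k \in C /\ x0 (g * k) = x k.
  by exists C, x0; split=> // x Xx; apply: x0P; rewrite // mem_enum.
elim: (enum _) => [|w s [C [x0 [Xx0 x0P]]]]; first by exists fset0, x1.
have [[y [Xy yw]]|nw] := pselect (exists y, shift_set X y /\ restr K y = w);
    last first.
  exists C, x0; split=> // x Xx; rewrite inE => /predU1P[xw|/x0P]; last exact.
  by case: nw; exists x.
have [g gfar] := fresh_translate (fmul C B) K Ginf.
have gX := shift_set_invariant g Xy.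
pose gK := ltranslate g K.
have [|z [Xz zC zgK]] := glX C gK _ x0 (shift_act g y) Xx0 gX.
  move=> c _ cC /imfsetP[k /= kK ->].
  apply: contra (gfar _ kK) => cgk; apply/fmulP.
  by exists c, (c^-1 * (g * k)); rewrite mulVKg.
exists (C `|` gK)%fset, z; split=> // x Xx; rewrite inE.
have mem_gK k : k \in K -> g * k \in gK by move=> kK; apply: in_imfset.
case/predU1P => [xw|/(x0P x Xx)[h hP]].
  exists g => k kK; rewrite inE mem_gK ?orbT //; split=> //.
  rewrite zgK ?mem_gK // /shift_act mulKg.
  by move: k kK; apply/eq_restrP; rewrite yw xw.
by exists h => k /hP[hkC hk]; rewrite inE hkC zC.
Qed.

(** * Subshifts marked by occurrences of a pattern *)

Definition occurs F p x d := {in F, forall f, x (d * f) = p f}.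

Definition marked_set X U F p : set (config G A) :=
  [set x | shift_set X x /\ forall g, exists2 u, u \in U & occurs F p x (g * u)].

Lemma marked_closed X U F p : closed (marked_set X U F p).
Proof.
have -> : marked_set X U F p = shift_set X `&`
    \bigcap_g [set x | exists2 u, u \in U & occurs F p x (g * u)].
  apply/seteqP; split=> x [Xx xU]; split=> // g; first by move=> _; apply: xU.
  exact: xU.
apply: closedI; first exact: shift_set_closed.
apply: closed_bigI => g _.
apply: (@closed_local _ _ (fmul (fmul [fset g]%fset U) F)) => x y xy [u uU yu].
by exists u => // f fF; rewrite -yu // xy // !mem_fmul ?inE.
Qed.

Lemma occurs_shift_act F p x g d :
  occurs F p (shift_act g x) d <-> occurs F p x (g^-1 * d).
Proof. by split=> xp f fF; have := xp f fF; rewrite /shift_act mulgA. Qed.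

Lemma marked_invariant X U F p g x :
  marked_set X U F p x -> marked_set X U F p (shift_act g x).
Proof.
move=> [Xx xU]; split=> [|h]; first exact: shift_set_invariant.
have [u uU xu] := xU (g^-1 * h); exists u => //.
by apply/occurs_shift_act; rewrite mulgA.
Qed.

Definition marked X U F p :=
  Subshift (@marked_closed X U F p) (@marked_invariant X U F p).

(** For symmetric [B], it contains [g^-1 * d] as soon as the translates of [F] by [g] and [d] have
    [B]-close points. *)
Definition window B F := fmul (fmul F B) (finv F).

Lemma mem_window B F f b f' :
  f \in F -> b \in B -> f' \in F -> f * b * f'^-1 \in window B F.
Proof. by move=> fF bB f'F; rewrite !mem_fmul ?mem_finv. Qed.

Section Marking.
Variables (X : subshift G A) (B F : {fset G}) (p : config G A).
Hypotheses (B1 : 1 \in B) (Bsym : forall b, b \in B -> b^-1 \in B).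
Hypotheses (glX : glues B X) (F1 : 1 \in F) (Xp : shift_set X p).
Let U := window B F.

(* Greedy: a translate of F far from everything prescribed so far can be filled
   with p, and one close to an earlier occurrence needs no new occurrence,
   because that occurrence lies in its window. *)
Lemma extend_marked z0 C Q : shift_set X z0 ->
  {in Q, forall d, occurs F p z0 d} ->
  (forall (g : G) c f, c \in C -> f \in F -> c^-1 * (g * f) \in B ->
    exists2 d, d \in Q & g^-1 * d \in U) ->
  exists2 z, shift_set (marked X U F p) z & {in C, z =1 z0}.
Proof.
move=> Xz0 z0Q nearC.
pose V (g : G) : set (config G A) := [set z | [/\ shift_set X z, {in C, z =1 z0} &
  exists2 u, u \in U & occurs F p z (g * u)]].
suff [z zV] : exists z, forall g, V g z.
  exists z; last by have [] := zV 1.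
  by split=> [|g]; [have [] := zV 1|have [] := zV g].
apply: config_finI => [g|s].
  have -> : V g = shift_set X `&` ([set z : config G A | {in C, z =1 z0}] `&`
      [set z : config G A | exists2 u, u \in U & occurs F p z (g * u)]).
    by apply/seteqP; split=> z; [case|case=> ? []].
  apply: closedI; first exact: shift_set_closed.
  apply: closedI.
    by apply: (@closed_local _ _ C) => x y xy yC c cC; rewrite xy // yC.
  apply: (@closed_local _ _ (fmul (fmul [fset g]%fset U) F)) => x y xy [u uU yu].
  by exists u => // f fF; rewrite -yu // xy // !mem_fmul ?inE.
(* Compactness leaves finitely many [g], treated one at a time; [Q'] records the positions of the
   occurrences secured so far. *)
have [z [Q' [Xz zC QQ' zQ' sQ']]] : exists z Q', [/\ shift_set X z,
    {in C, z =1 z0}, {subset Q <= Q'}, {in Q', forall d, occurs F p z d} &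
    forall g, g \in s -> exists2 d, d \in Q' & g^-1 * d \in U].
  elim: s => [|g s [z [Q' [Xz zC QQ' zQ' sQ']]]]; first by exists z0, Q; split.
  have [gQ'|gQ'] := pselect (exists2 d, d \in Q' & g^-1 * d \in U).
    by exists z, Q'; split=> // h; rewrite inE => /predU1P[->//|/sQ'].
  have Xgp := shift_set_invariant g Xp.
  have [|t [Xt tz tg]] := @glX (C `|` fmul Q' F)%fset (ltranslate g F) _ z _ Xz Xgp.
    move=> c _ + /imfsetP[f /= fF ->].
    rewrite inE => /orP[cC|/fmulP[d [f' [dQ' f'F ->]]]]; apply/negP => cgf.
      have [d dQ gd] := nearC g c f cC fF cgf.
      by apply: gQ'; exists d => //; apply: QQ'.
    apply: gQ'; exists d => //.
    have -> : g^-1 * d = f * ((d * f')^-1 * (g * f))^-1 * f'^-1.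
      by rewrite !invgM !invgK !mulgA mulgV mul1g mulgK.
    by apply: mem_window => //; apply: Bsym.
  exists t, (g |` Q')%fset; split=> //.
  - by move=> c cC; rewrite tz ?zC // inE cC.
  - by move=> d /QQ' dQ'; rewrite inE dQ' orbT.
  - move=> d; rewrite !inE => /predU1P[->|dQ'] f fF.
      rewrite tg /shift_act ?mulKg //.
      exact: in_imfset.
    by rewrite tz ?zQ' // inE mem_fmul ?orbT.
  - move=> h; rewrite inE => /predU1P[->|/sQ'[d dQ' hd]].
      exists g; first by rewrite !inE eqxx.
      by rewrite mulVg -[1](mulgV 1) -[X in X * _](mulg1 1); apply: mem_window.
    by exists d; rewrite // inE dQ' orbT.
exists z => g /sQ'[d dQ' gd]; split=> //.
by exists (g^-1 * d) => //; rewrite mulVKg; apply: zQ'.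
Qed.

Lemma marked_nonempty : shift_set (marked X U F p) !=set0.
Proof.
have [d|g c f|z Yz _] := @extend_marked p fset0 fset0 Xp; rewrite ?in_fset0 //.
by exists z.
Qed.

(** The occurrences of [p] in [y1] near [K] and in [y2] near [H] are prescribed as well and glued in
    [X]; [extend_marked] then serves all other windows. *)
Lemma marked_glues : exists B', glues B' (marked X U F p).
Proof.
(* If the translate of [F] by [g] comes [B]-close to [c], then [W] contains the displacement from
   [c] to any [g * u] with [u] in [U]; [V] adds the cells of an occurrence there. *)
pose W := fmul (fmul B (finv F)) U.
pose V := (1 |` fmul W F)%fset.
exists (fmul (fmul V B) (finv V)) => K H KH y1 y2 [Xy1 y1U] [Xy2 y2U].
pose Q L y := [fset d in fmul L W | `[< occurs F p y d >]]%fset.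
pose N L y := (L `|` fmul (Q L y) F)%fset.
have QP L y d : d \in Q L y -> d \in fmul L W /\ occurs F p y d.
  by rewrite !inE => /andP[dLW /asboolP].
have NV L y n : n \in N L y -> exists l v, [/\ l \in L, v \in V & n = l * v].
  rewrite inE => /orP[nL|/fmulP[d [f [/QP[/fmulP[l [w [lL wW ->]]] _] fF ->]]]].
    by exists n, 1; rewrite mulg1 !inE eqxx.
  by exists l, (w * f); rewrite mulgA !inE mem_fmul ?orbT.
have nearL L y g c f : (forall g, exists2 u, u \in U & occurs F p y (g * u)) ->
    c \in L -> f \in F -> c^-1 * (g * f) \in B ->
    exists2 d, d \in Q L y & g^-1 * d \in U.
  move=> yU cL fF cgf; have [u uU yu] := yU g.
  exists (g * u); last by rewrite mulKg.
  rewrite !inE; apply/andP; split; last exact/asboolP.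
  have -> : g * u = c * (c^-1 * (g * f) * f^-1 * u).
    by rewrite !mulgA mulgV mul1g mulgK.
  by rewrite !mem_fmul ?mem_finv.
have [|z0 [Xz0 z0K z0H]] := @glX (N K y1) (N H y2) _ y1 y2 Xy1 Xy2.
  move=> _ _ /NV[k [v [kK vV ->]]] /NV[h [w [hH wV ->]]].
  apply: contra (KH _ _ kK hH) => kh.
  have -> : k^-1 * h = v * ((k * v)^-1 * (h * w)) * w^-1.
    by rewrite invgM !mulgA mulgV mul1g mulgK.
  by rewrite !mem_fmul ?mem_finv.
have [|g c f|z Yz zC] :=
    @extend_marked z0 (K `|` H)%fset (Q K y1 `|` Q H y2)%fset Xz0.
- move=> d; rewrite in_fsetU => /orP[] dQ f fF; have [_ yd] := QP _ _ _ dQ.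
    by rewrite z0K ?yd // inE mem_fmul ?orbT.
  by rewrite z0H ?yd // inE mem_fmul ?orbT.
- rewrite inE => /orP[cK|cH] fF cgf.
    have [d dQ gd] := nearL _ _ _ _ _ y1U cK fF cgf.
    by exists d; rewrite // in_fsetU dQ.
  have [d dQ gd] := nearL _ _ _ _ _ y2U cH fF cgf.
  by exists d; rewrite // in_fsetU dQ orbT.
exists z; split=> // c cL; rewrite zC ?inE ?cL ?orbT //.
  by rewrite z0K // inE cL.
by rewrite z0H // inE cL.
Qed.

End Marking.

End Gluing.

(** * Approximation from inside by sparse subshifts *)

Section SparseSubshift.
Context {G : groupType} {A : finType}.
Implicit Types (X Y Z : subshift G A) (x y z : config G A) (B K : {fset G}).
Local Open Scope group_scope.

Definition approx K Z X := shift_set Z `<=` shift_set X /\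
  forall x, shift_set X x -> exists2 z, shift_set Z z & {in K, z =1 x}.

Lemma approxS K K' Z X : (K `<=` K')%fset -> approx K' Z X -> approx K Z X.
Proof.
move=> /fsubsetP KK' [ZX XZ]; split=> // x /XZ[z Zz zx].
by exists z => // k /KK'; exact: zx.
Qed.

Lemma approx_trans K X Y Z : approx K Z Y -> approx K Y X -> approx K Z X.
Proof.
move=> [ZY YZ] [YX XY]; split=> [z /ZY/YX//|x /XY[y /YZ[z Zz zy] yx]].
by exists z => // k kK; rewrite zy // yx.
Qed.

Lemma open_approx (O : set (subshift G A)) X : open O -> O X ->
  exists K, forall Z, approx K Z X -> O Z.
Proof.
move=> oO OX; have : nbhs X O by apply: open_nbhs_nbhs.
rewrite -nbhs_entourageE => -[V [E /entourage_configP[K KE] EU] UO].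
exists K => Z [ZX XZ]; apply: UO; rewrite /xsection /= inE; apply: EU.
split=> /= [x /XZ[z Zz zx]|z Zz].
  by exists z => //; apply: KE; apply/eq_restrP => k /zx.
by exists z; [exact: ZX|apply: KE].
Qed.

(** A failure of gluing involves finitely many cells, and a glued point found in [Z] would also lie
    in [X]. *)
Lemma not_glues_approx B X : ~ glues B X ->
  exists K, forall Z, approx K Z X -> ~ glues B Z.
Proof.
apply: contra_notP => noK K H KH x y Xx Xy.
have [Z [ZX XZ] glZ] : exists2 Z, approx (K `|` H)%fset Z X & glues B Z.
  apply: contra_notP noK => noZ; exists (K `|` H)%fset => Z ZX glZ.
  by apply: noZ; exists Z.
have [x' Zx' xx'] := XZ x Xx; have [y' Zy' yy'] := XZ y Xy.
have [z [Zz zx zy]] := glZ K H KH x' y' Zx' Zy'.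
exists z; split=> [|k kK|h hH]; first exact: ZX.
  by rewrite zx // xx' // inE kK.
by rewrite zy // yy' // inE hH orbT.
Qed.

Lemma exists_fset_card n : infinite_set [set: G] ->
  exists E : {fset G}, #|` E| = n.
Proof.
move=> Ginf; elim: n => [|n [E En]]; first by exists fset0; rewrite cardfs0.
have [g /(_ 1)] := fresh_translate E [fset 1]%fset Ginf.
rewrite mulg1 inE eqxx => /(_ isT) gE.
by exists (g |` E)%fset; rewrite cardfsU1 gE En.
Qed.

(** By invariance, two distinct letters are then available at every element of the group. *)
Definition nontrivial X :=
  exists x y, [/\ shift_set X x, shift_set X y & x 1 <> y 1].

Lemma marked_not_glues X B0 F U p : 1 \in B0 ->
  (forall b, b \in B0 -> b^-1 \in B0) ->
  (exists2 m, (#|` U| < 2 ^ m)%N & exists F',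
    (fmul F' B0 `<=` F)%fset /\ (#|` B0| * m <= #|` F'|)%N) ->
  nontrivial (marked X U F p) -> ~ glues B0 (marked X U F p).
Proof.
move=> B01 B0sym [m ltU [F' [/fsubsetP F'F leF']]].
move=> [ya [yb [Yya Yyb ab]]] glY.
have [P [_ Psep Pmax]] := maximal_separated (fmul U F) B01 B0sym.
(* [D u] is the part of [P] in the translate of [F] by [u]; [w u] tells which of its points carry
   [ya 1] if [p] occurs at [u]. *)
pose D (u : U) : {set P} := finset (fun t : P => (val u)^-1 * val t \in F).
pose w (u : U) (t : P) := p ((val u)^-1 * val t) == ya 1.
have mD (u : U) : (m <= #|D u|)%N.
  (* By maximality of [P], the translate of [F'] by [u] is covered by [fmul Pu B0], where [Pu] is
     [D u] seen in the group. *)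
  rewrite -(@leq_pmul2l #|` B0|); last by rewrite cardfs_gt0; apply/fset0Pn; exists 1.
  apply: leq_trans leF' _; rewrite mulnC.
  pose Pu := [fset val t | t in D u]%fset.
  have -> : #|D u| = #|` Pu| by rewrite card_imfset ?cardE //; exact: val_inj.
  apply: leq_trans (card_fmul Pu B0).
  have <- : #|` ltranslate (val u) F'| = #|` F'|.
    by rewrite card_imfset //; exact: mulgI.
  apply/fsubset_leq_card/fsubsetP => _ /imfsetP[f /= fF' ->].
  have fF : f \in F by apply: F'F; rewrite -[f]mulg1 mem_fmul.
  have [q qP qf] := Pmax _ (mem_fmul (valP u) fF).
  apply/fmulP; exists q, (q^-1 * (val u * f)); rewrite mulVKg; split=> //.
  apply/imfsetP; exists [` qP]%fset => //=; rewrite inE /=.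
  have -> : (val u)^-1 * q = f * (q^-1 * (val u * f))^-1.
    by rewrite !invgM invgK !mulgA mulgV mul1g.
  by rewrite F'F // mem_fmul // B0sym.
have [|f fP] := @avoid_partial_assignments _ _ D w m mD; first by rewrite -cardfE.
pose v q := if oapp f true (insub q) then ya 1 else yb 1.
have [|q|z [_ zU] zP] := @glue_separated _ _ _ _ _ v glY _ Psep; first by exists ya.
  have [b yE Yb] : exists2 y, y 1 = v q & shift_set (marked X U F p) y.
    by rewrite /v; case: ifP => _; [exists ya|exists yb].
  exists (shift_act q b); first exact: shift_set_invariant.
  by rewrite /shift_act mulVg.
(* Some [u] in [U] carries an occurrence in [z], yet [f] was chosen to contradict it at a point [t]
   of [D u]. *)
have [u uU zu] := zU 1.
have [t tD] := fP [` uU]%fset; move: tD; rewrite inE /= /w /= => utF.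
have := zP _ (valP t); have := zu _ utF; rewrite mul1g mulVKg => -> ->.
rewrite /v valK /=; case: (f t) => /=; first by rewrite eqxx.
by case: (yb 1 =P ya 1) => // /esym/ab.
Qed.

Lemma sparse_approx X B B0 K : infinite_set [set: G] ->
  glues B X -> nontrivial X -> exists Y, [/\ approx K Y X, nontrivial Y,
    exists B', glues B' Y & ~ glues B0 Y].
Proof.
move=> Ginf glX [xa [xb [Xxa Xxb ab]]].
have [B' [BB' B'1 B'sym]] := symmetric_superset B.
have {glX}glX := gluesS BB' glX.
have [B0' [B0B0' B0'1 B0'sym]] := symmetric_superset B0.
have X0 : shift_set X !=set0 by exists xa.
(* Including 1 preserves the letters at 1, which keeps [Y] nontrivial. *)
have [C [p [Xp pP]]] := universal_pattern (1 |` K)%fset Ginf glX X0.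
(* Here |F| <= |C| + 1 + |B0'|^2 m, because [F'] has |B0'| m elements; the window has at most |F|^2
   |B'| elements. *)
have [m ltm] := exists_square_lt_exp2 #|` C|.+1 (#|` B0'| ^ 2) #|` B'|.
have [F' cardF'] := exists_fset_card (#|` B0'| * m) Ginf.
pose F := (1 |` (C `|` fmul F' B0'))%fset.
have F1 : 1 \in F by rewrite !inE eqxx.
pose Y := marked X (window B' F) F p.
have YX : approx (1 |` K)%fset Y X.
  split=> [y []//|x /pP[g gP]].
  have [y Yy] := marked_nonempty B'1 B'sym glX F1 Xp.
  (* The occurrence at [u] contains a copy of the pattern of [x] at [u * g], which a shift brings
     back to [K]. *)
  have [u uU yu] := Yy.2 1.
  exists (shift_act (u * g)^-1 y); first exact: shift_set_invariant.
  move=> k /gP[gkC <-]; rewrite /shift_act invgK -mulgA.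
  by rewrite -yu ?mul1g // !inE gkC orbT.
have Ynt : nontrivial Y.
  have [_ XY] := YX; have [ya Yya yaE] := XY _ Xxa; have [yb Yyb ybE] := XY _ Xxb.
  by exists ya, yb; rewrite yaE ?ybE // !inE eqxx.
exists Y; split=> //.
- by apply: approxS YX; exact: fsubsetUr.
- exact: marked_glues.
- move=> /(gluesS B0B0'); apply: marked_not_glues => //; exists m; last first.
    exists F'; rewrite cardF' leqnn; split=> //.
    by apply/fsubsetP => f fF; rewrite !inE fF !orbT.
  apply: leq_ltn_trans ltm; apply: leq_trans (card_fmul _ _) _.
  have leF : (#|` F| <= #|` C|.+1 + #|` B0'| ^ 2 * m)%N.
    rewrite cardfsU1; apply: (@leq_trans (1 + (#|` C| + #|` fmul F' B0'|))).
      by rewrite leq_add ?leq_b1 // cardfsU leq_subr.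
    rewrite add1n addSn ltnS leq_add2l; apply: leq_trans (card_fmul _ _) _.
    by rewrite cardF' mulnAC.
  rewrite card_finv; apply: (@leq_trans (#|` F| ^ 2 * #|` B'|)).
    by rewrite -mulnn mulnAC leq_mul // card_fmul.
  by rewrite leq_mul // leq_exp2r.
Qed.

Lemma full_shift_glues X : shift_set X = setT -> glues [fset 1]%fset X.
Proof.
move=> XT K H KH x y _ _; exists (fun h => if h \in K then x h else y h).
split=> [|k kK|h hH]; rewrite ?XT ?kK //; case: ifP => // hK.
by have := KH _ _ hK hH; rewrite mulVg inE eqxx.
Qed.

End SparseSubshift.

(** * Word balls and strong irreducibility *)

Section WordBalls.
Context {G : groupType}.
Variable S : {fset G}.
Local Open Scope group_scope.

Definition word_ball n : {fset G} :=
  iter n (fun E => E `|` fmul (S `|` finv S) E)%fset [fset 1]%fset.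

Lemma word_ballP n g : reflect
  (exists w, [/\ word_over S w, (size w <= n)%N & g = \prod_(s <- w) s])
  (g \in word_ball n).
Proof.
have mem_letters s : (s \in S `|` finv S)%fset = (s \in S) || (s^-1 \in S).
  by rewrite inE -{2}(invgK s) mem_finv.
elim: n g => [|n IHn] g.
  rewrite inE; apply: (iffP eqP) => [->|[w []]]; first by exists [::]; rewrite big_nil.
  by rewrite leqn0 size_eq0 => _ /eqP-> ->; rewrite big_nil.
rewrite /= inE; apply: (iffP orP) => [[/IHn[w [Sw wn ->]]|]|].
- by exists w; rewrite Sw ltnW.
- move=> /fmulP[s [_ [sS /IHn[w [Sw wn ->]] ->]]].
  by exists (s :: w); rewrite /= -mem_letters sS big_cons.
- move=> [[|s w]] [/= Sw wn ->].
    by left; apply/IHn; exists [::].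
  right; move: Sw => /andP[sS Sw]; rewrite big_cons mem_fmul ?mem_letters //.
  by apply/IHn; exists w.
Qed.

Lemma word_ball_cover (B : {fset G}) : generates S ->
  exists n, (B `<=` word_ball n)%fset.
Proof.
move=> genS; suff [n Bn] : exists n, {subset enum_fset B <= word_ball n}.
  by exists n; apply/fsubsetP.
elim: (enum_fset B) => [|b s [n sn]]; first by exists 0.
have [m [w [Sw wm wE]]] := genS b.
exists (maxn m n) => x; rewrite inE => /predU1P[->|/sn/word_ballP[v [Sv vn ->]]].
  by apply/word_ballP; exists w; rewrite wm leq_maxl wE.
by apply/word_ballP; exists v; rewrite leq_max vn orbT.
Qed.

Lemma word_dist_ball n g h : generates S ->
  (n < word_dist S g h)%N = (g^-1 * h \notin word_ball n).
Proof.
move=> genS; rewrite ltnNge; congr (~~ _).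
apply/idP/word_ballP.
  move=> /word_distP-/(_ genS)[w [Sw wn ->]]; exists w; rewrite mulKg.
  by split.
by move=> [w [Sw wn gh]]; apply/word_distP => //; exists w; rewrite -gh mulVKg.
Qed.

Lemma strongly_irreducible_glues {A : finType} (X : subshift G A) : generates S ->
  strongly_irreducible S X <-> exists n, glues (word_ball n) X.
Proof.
move=> genS; split=> -[n glX]; exists n => K H KH x y Xx Xy.
  have [|z [Xz /eq_restrP zx /eq_restrP zy]] := glX K H _ x y Xx Xy.
    by move=> k h kK hH; rewrite word_dist_ball // KH.
  by exists z.
have [|z [Xz zx zy]] := glX K H _ x y Xx Xy.
  by move=> k h kK hH; rewrite -word_dist_ball // KH.
by exists z; split=> //; apply/eq_restrP.
Qed.

End WordBalls.

(** * Limits of decreasing sequences of subshifts *)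

Section DecreasingSequences.
Context {G : groupType} {A : finType}.
Variables (X : nat -> subshift G A) (K : nat -> {fset G}).
Hypothesis XK : forall n, approx (K n) (X n.+1) (X n).
Hypothesis KS : forall n, (K n `<=` K n.+1)%fset.

Lemma bigcap_subshift_closed : closed (\bigcap_n shift_set (X n)).
Proof. by apply: closed_bigI => n _; exact: shift_set_closed. Qed.

Lemma bigcap_subshift_invariant g x : (\bigcap_n shift_set (X n)) x ->
  (\bigcap_n shift_set (X n)) (shift_act g x).
Proof. by move=> Xx n _; apply: shift_set_invariant; exact: Xx. Qed.

Definition bigcap_subshift :=
  Subshift bigcap_subshift_closed bigcap_subshift_invariant.

Lemma approx_le m n : (m <= n)%N -> approx (K m) (X n) (X m).
Proof.
have Kle i j : (i <= j)%N -> (K i `<=` K j)%fset.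
  by elim: j => [|j IHj]; rewrite leq_eqVlt => /predU1P[->|//] //;
     move=> /IHj Kij; apply: fsubset_trans Kij (KS j).
elim: n => [|n IHn]; first by rewrite leqn0 => /eqP->; split=> // x; exists x.
rewrite leq_eqVlt => /predU1P[->|mn]; first by split=> // x; exists x.
apply: approx_trans (IHn mn); exact: approxS (Kle m n mn) (XK n).
Qed.

(** The points of [X i] equal to [x] on [K n] form closed sets; finitely many of them share a point
    of [X N] for large [N], so compactness applies. *)
Lemma approx_bigcap_subshift n : approx (K n) bigcap_subshift (X n).
Proof.
split=> [x|x Xx]; first exact.
pose C i := shift_set (X i) `&` [set z : config G A | {in K n, z =1 x}].
have [i|s|z zC] := @config_finI _ _ _ C.
- apply: closedI; first exact: shift_set_closed.
  by apply: (@closed_local _ _ (K n)) => y z yz zx k kK; rewrite yz // zx.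
- have [N [nN sN]] : exists N, (n <= N)%N /\ forall i, i \in s -> (i <= N)%N.
    exists (maxn n (\max_(i <- s) i)); split=> [|i si]; first exact: leq_maxl.
    by rewrite leq_max; apply/orP; right; exact: (@leq_bigmax_seq _ s xpredT id i si).
  have [_ /(_ _ Xx)[z Xz zx]] := approx_le nN.
  by exists z => i /sN iN; split=> //; have [XN _] := approx_le iN; exact: XN.
- by exists z => [i _|]; [have [] := zC i|have [] := zC 0].
Qed.

End DecreasingSequences.

(** * The Baire argument *)

Unset Implicit Arguments.
Set Strict Implicit.

Theorem corollary1p7 (G : groupType) (A : finType) (S : {fset G})
    (countableG : countable [set: G]) (infiniteG : infinite_set [set: G])
    (genS : generates S) (amenableG : amenable G)
    (A_gt1 : (1 < #|A|)%N) :
  ~ Gdelta [set X : subshift G A | strongly_irreducible S X].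
Proof.
move=> [O oO SIO].
pose good (s : subshift G A * {fset G}) :=
  nontrivial s.1 /\ exists B, glues B s.1.
(* The last clause makes what is achieved at stage [n] survive in the limit. *)
pose step n (s t : subshift G A * {fset G}) :=
  [/\ good t, approx s.2 t.1 s.1, (s.2 `<=` t.2)%fset &
    forall Z, approx t.2 Z t.1 -> O n Z /\ ~ glues (word_ball S n) Z].
have ex_step (ns : nat * (subshift G A * {fset G})) :
    exists t, good ns.2 -> step ns.1 ns.2 t.
  case: ns => n [X K] /=; have [[Xnt [B glX]]|] := pselect (good (X, K)); last first.
    by exists (X, K).
  have [Y [YX Ynt glY nglY]] := sparse_approx (word_ball S n) K infiniteG glX Xnt.
  (* Being strongly irreducible, [Y] lies in every [O i]. *)
  have OY : O n Y.
    suff : (\bigcap_i O i) Y by apply.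
    rewrite -SIO; apply/(strongly_irreducible_glues Y genS).
    have [B' glB'] := glY; have [i B'i] := word_ball_cover B' genS.
    by exists i; exact: gluesS glB'.
  have [K1 K1P] := open_approx (oO n) OY; have [K2 K2P] := not_glues_approx nglY.
  exists (Y, K `|` (K1 `|` K2))%fset => _; split=> //=; first exact: fsubsetUl.
  move=> Z ZY; split.
    apply: K1P; apply: approxS ZY.
    by apply: fsubset_trans (fsubsetUl _ K2) (fsubsetUr _ _).
  apply: K2P; apply: approxS ZY.
  by apply: fsubset_trans (fsubsetUr K1 _) (fsubsetUr _ _).
have [next nextP] := choice ex_step.
have [full fullT] : exists X : subshift G A, shift_set X = setT.
  by exists (@Subshift G A setT closedT (fun _ _ => id)).
have good0 : good (full, fset0).
  split; last by exists [fset 1%g]%fset; exact: full_shift_glues.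
  have /card_gt1P[a [b [_ _ ab]]] := A_gt1.
  by exists (fun=> a), (fun=> b); rewrite /= fullT; split=> //; exact/eqP.
pose s n := iteri n (fun i t => next (i, t)) (full, fset0).
have good_s n : good (s n).
  by elim: n => // n IHn; have [] := nextP (n, s n) IHn.
have sP n : step n (s n) (s n.+1) by exact: nextP (n, s n) (good_s n).
pose X n := (s n).1; pose K n := (s n).2.
have XK n : approx (K n) (X n.+1) (X n) by have [] := sP n.
have KS n : (K n `<=` K n.+1)%fset by have [] := sP n.
have ZX := approx_bigcap_subshift XK KS; set Z := bigcap_subshift X in ZX.
have ZP n : O n Z /\ ~ glues (word_ball S n) Z.
  by have [_ _ _] := sP n; apply; exact: ZX.
have : [set X : subshift G A | strongly_irreducible S X] Z.
  by rewrite SIO => n _; have [] := ZP n.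
(* Some ball is gluing for [Z], but stage [n] excluded the ball of radius [n]. *)
move=> /(strongly_irreducible_glues Z genS)[n glZ].
by have [] := ZP n.
Qed.
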